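(* Let $H$ be an initial-closed graph with $\mu(H)=(\mu_1,\ldots,\mu_s,0,\ldots,0)\in\mathbb N^{n-1}$, where $1\le s\le n-3$ and $0<\mu_s\le\cdots\le\mu_1$. If $\mu_1<n-s$, then $$\mathrm{pd}(H)\le\max_{1\le j\le s}\{2(n-1)-(\mu_j+j)\}.$$ In particular, if $\mu_s<\cdots<\mu_1<n-s$, then $\mathrm{pd}(H)=2(n-1)-(\mu_s+s)$.
   Context: A graph $G$ on $\{1,\ldots,n\}$ (finite, simple) is closed (with respect to this labelling) if whenever $\{i,j\},\{i,k\}$ ($j\ne k$) are edges with either $i<j,i<k$ or $i>j,i>k$, then $\{j,k\}$ is an edge. A cut point of a connected graph is a vertex whose removal disconnects it. Let $G$ be a connected closed graph on $\{1,\ldots,n\}$, $n\ge2$, without cut point. Its initial-closed graph $H$ is the (connected, bipartite) graph with vertices $x_1,\ldots,x_{n-1}$ and (after renaming $y_j$ as $y_{j-1}$) $y_1,\ldots,y_{n-1}$, where $x_i$ is adjacent to $y_{j-1}$ iff $i<j$ and $\{i,j\}\in E(G)$. Put $\mu(H)=(\mu_1,\ldots,\mu_{n-1})$, $\mu_i:=n-i-\deg_H(x_i)$. Then $\mu_1\ge\cdots\ge\mu_{n-1}=0$ (with $\mu_{n-2}=0$ when $n\ge3$), $\mu_i\le n-2-i$ for $1\le i\le n-3$, and the edge ideal of $H$ is $I(H)=(x_iy_j\mid 1\le i\le n-1,\ i\le j\le n-1-\mu_i)$. For a graph $H$ and a fixed field $\Bbbk$, $I(H)\subseteq\Bbbk[V(H)]$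 is the edge ideal (generated by the products of adjacent vertices) and $\mathrm{pd}(H):=\mathrm{pd}(\Bbbk[V(H)]/I(H))$. *)

(* Defs.v *)
From HB Require Import structures.
From mathcomp Require Import all_boot all_order all_algebra.
From mathcomp Require Import generic_quotient ring_quotient.
From mathcomp Require Import boolp.
From mathcomp Require Import mpoly.

Set Implicit Arguments.
Unset Strict Implicit.
Unset Printing Implicit Defensive.

Import GRing.Theory.
Local Open Scope ring_scope.
Local Open Scope quotient_scope.

Section QuotientModule.
Variables (R : nzRingType) (V : lmodType R) (U : {pred V}).
Variable U_closed : submod_closed U.

(* U under a name that carries U_closed, so that the closure instances needed
   by Quotient.quot can be attached to it. *)
Definition submod_pred of submod_closed U : {pred V} := U.

HB.instance Definition _ :=
  GRing.isSubmodClosed.Build R V (submod_pred U_closed) U_closed.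

Local Notation Q := (Quotient.quot (submod_pred U_closed)).

Definition quot_mod : Type := Q.

HB.instance Definition _ := GRing.Zmodule.on quot_mod.

Definition quot_scale (a : R) (x : quot_mod) : quot_mod :=
  \pi_Q (a *: repr x).

Lemma quot_scale_pi a (v : V) :
  quot_scale a (\pi_Q v) = \pi_Q (a *: v).
Proof.
apply/eqP; rewrite /quot_scale -Quotient.idealrBE -scalerBr.
by rewrite (rpredZ a) // Quotient.idealrBE reprK.
Qed.

Lemma quot_scaleA a b (x : quot_mod) :
  quot_scale a (quot_scale b x) = quot_scale (a * b) x.
Proof. by rewrite [quot_scale b x]/quot_scale quot_scale_pi scalerA. Qed.

Lemma quot_scale1 : left_id 1 quot_scale.
Proof. by move=> x; rewrite /quot_scale scale1r reprK. Qed.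

Lemma quot_scaleDr : right_distributive quot_scale +%R.
Proof.
move=> a x y; have -> : x + y = \pi_Q (repr x + repr y).
  by rewrite Quotient.pi_add !reprK.
by rewrite quot_scale_pi scalerDr Quotient.pi_add.
Qed.

Lemma quot_scaleDl (x : quot_mod) : {morph quot_scale^~ x : a b / a + b}.
Proof. by move=> a b; rewrite /quot_scale scalerDl Quotient.pi_add. Qed.

HB.instance Definition _ := GRing.Zmodule_isLmodule.Build R quot_mod
  quot_scaleA quot_scale1 quot_scaleDr quot_scaleDl.

End QuotientModule.

Section ProjectiveDimension.
Variable R : nzRingType.

Definition surj (A B : Type) (f : A -> B) := forall y, exists x, f x = y.

Definition exact_at (A B C : lmodType R) (f : A -> B) (g : B -> C) :=
  forall y, g y = 0 <-> exists x, f x = y.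

Definition projective (P : lmodType R) : Prop :=
  forall (A B : lmodType R) (g : {linear A -> B}) (f : {linear P -> B}),
    surj g -> exists h : {linear P -> A}, forall x, g (h x) = f x.

Record proj_resolution (M : lmodType R) := ProjResolution {
  res_mod : nat -> lmodType R;
  res_diff : forall i, {linear res_mod i.+1 -> res_mod i};
  res_aug : {linear res_mod 0%N -> M};
  res_projective : forall i, projective (res_mod i);
  res_aug_surj : surj res_aug;
  res_exact0 : exact_at (res_diff 0) res_aug;
  res_exactS : forall i, exact_at (res_diff i.+1) (res_diff i)
}.

Definition length_le (M : lmodType R) (P : proj_resolution M) (d : nat) :=
  forall i, (d < i)%N -> forall x : res_mod P i, x = 0.

(* pd M is the least length of a projective resolution of M, and infinite when
   there is no finite one. *)
Definition pd_le (M : lmodType R) (d : nat) : Prop :=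
  exists P : proj_resolution M, length_le P d.

Definition pd_eq (M : lmodType R) (d : nat) : Prop :=
  pd_le M d /\ forall e, pd_le M e -> (d <= e)%N.

End ProjectiveDimension.

Section EdgeIdeal.
Variables (k : fieldType) (T : finType) (e : rel T).

Definition vertex_ring : comNzRingType := {mpoly k[#|T|]}.

Definition vertex_var (v : T) : vertex_ring := 'X_(enum_rank v).

Definition edge_ideal : {pred vertex_ring^o} := fun p =>
  `[< exists c : T * T -> vertex_ring,
        p = \sum_(uv | e uv.1 uv.2)
              c uv * (vertex_var uv.1 * vertex_var uv.2) >].

Lemma edge_ideal_submod_closed : submod_closed edge_ideal.
Proof.
split.
  apply/asboolP; exists (fun _ => 0).
  by rewrite big1 // => uv _; rewrite mul0r.
move=> a p q /asboolP[c ->] /asboolP[d ->]; apply/asboolP.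
exists (fun uv => a * c uv + d uv); rewrite scaler_sumr -big_split /=.
by apply: eq_bigr => uv _; rewrite mulrDl -mulrA.
Qed.

(* k[V]/I(e), as a module over k[V]; pd of the graph is pd of this module. *)
Definition edge_quotient : lmodType vertex_ring := quot_mod edge_ideal_submod_closed.

Definition graph_pd_le (d : nat) : Prop := pd_le edge_quotient d.
Definition graph_pd_eq (d : nat) : Prop := pd_eq edge_quotient d.

End EdgeIdeal.

Section ClosedGraph.
Local Open Scope nat_scope.

Definition simple_graph (T : finType) (e : rel T) : Prop :=
  ssrbool.symmetric e /\ irreflexive e.

Definition connected_graph (T : finType) (e : rel T) : Prop :=
  forall x y, connect e x y.

Definition cut_point (T : finType) (e : rel T) (v : T) : Prop :=
  exists x y, [/\ x != v, y != v &
    ~~ connect [rel a b | [&& a != v, b != v & e a b]] x y].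

Variable n : nat.

(* The vertex i of {1, ..., n} is the ordinal i - 1. *)
Definition closed_graph (G : rel 'I_n) : Prop :=
  forall i j k : 'I_n, j != k -> G i j -> G i k ->
    (i < j) && (i < k) || (j < i) && (k < i) -> G j k.

Definition ord_keep (i : 'I_n.-1) : 'I_n := widen_ord (leq_pred n) i.

Lemma ord_succ_subproof (i : 'I_n.-1) : i.+1 < n.
Proof. by rewrite -ltn_predRL. Qed.

Definition ord_succ (i : 'I_n.-1) : 'I_n := Ordinal (ord_succ_subproof i).

(* inl i is x_(i+1).  After the renaming of y_j as y_(j-1), inr j is y_(j+1)
   and corresponds to the vertex j+2 of G, i.e. to the ordinal j+1. *)
Definition initial_graph (G : rel 'I_n) : rel ('I_n.-1 + 'I_n.-1) :=
  fun u v =>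
  match u, v with
  | inl i, inr j | inr j, inl i =>
      (ord_keep i < ord_succ j) && G (ord_keep i) (ord_succ j)
  | _, _ => false
  end.

Definition initial_closed (H : rel ('I_n.-1 + 'I_n.-1)) : Prop :=
  1 < n /\ exists G : rel 'I_n,
    [/\ simple_graph G, connected_graph G, closed_graph G,
        forall v, ~ cut_point G v & H =2 initial_graph G].

Definition degree (T : finType) (e : rel T) (v : T) : nat := #|[pred w | e v w]|.

Definition mu (H : rel ('I_n.-1 + 'I_n.-1)) : n.-1.-tuple nat :=
  [tuple n - i.+1 - degree H (inl i) | i < n.-1].

End ClosedGraph.

(* Main.v *)
From mathcomp Require Import finmap monalg.
Require Import Defs.
From HB Require Import structures.
From mathcomp Require Import all_boot all_order all_algebra.
From mathcomp Require Import generic_quotient ring_quotient boolp mpoly.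
From mathcomp Require Import zify.

Set Implicit Arguments.
Unset Strict Implicit.
Unset Printing Implicit Defensive.

Import GRing.Theory.

(** Write N = n - 1 and lam i = N - mu_i.  In a connected closed graph the
    neighbours of a vertex i that are larger than i form an interval starting at
    i + 1 ([closed_up_nbhd]), so that H is the staircase graph in which the row
    x_i meets exactly the columns y_j with i <= j < lam i, all indices starting
    at 0 ([initial_closed_edges]).  The hypothesis mu_1 < n - s says that
    s <= lam i for all i.

    The upper bound is a lower bound for the depth, that is, for
    #|A| - pd (k[A] / I(H[A])) where A is a set of vertices.  For a vertex v of A
    the colon ideal I : v is generated by the edge ideal of A without v and its
    neighbours, together with these neighbours, and I + (v) by the edge ideal
    of A without v, together with v.  The exact sequence
    0 -> S / (I : v) -> S / I -> S / (I + (v)) -> 0 then yields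
    depth A >= min (depth (A \ v), 1 + depth (A \ N[v])) ([depth_ge_vertex]).
    Splitting at the last column, then in each link at the first row, then in
    the Ferrers graph that is left at the last row, every leaf is an edgeless
    set, and its size plus the number of links taken on the way is at least
    min (mu_j + j) ([staircase_depth]).

    If mu decreases strictly then mu_j + j is smallest at j = s.  The first s
    rows and the last mu_s columns form a maximal independent set A with
    mu_s + s elements.  The class of the product of the variables in A is a
    nonzero element of S / I which is annihilated by every variable outside A;
    since variables form a regular sequence, pd (S / I) >= 2 N - #|A|
    ([annihilated_pd_ge], [graph_pd_ge_cover]).  This last step compares a
    projective resolution with the Koszul complex of these variables, which
    has no cohomology below the top degree on a projective module. *)

(** * Projective dimension and short exact sequences *)

Section LinearMaps.
Local Open Scope ring_scope.
Variable R : nzRingType.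
Implicit Types A B C X : lmodType R.

Lemma linear_of A B (f : A -> B) :
  linear f -> exists g : {linear A -> B}, forall x, g x = f x.
Proof.
move=> f_lin.
pose m := GRing.isLinear.Build R A B *:%R f f_lin.
by exists (HB.pack_for {linear A -> B} f m).
Qed.

Lemma linear_inj0 A B (f : {linear A -> B}) :
  (forall x, f x = 0 -> x = 0) -> injective f.
Proof.
by move=> f0 x y fxy; apply/eqP; rewrite -subr_eq0; apply/eqP/f0; rewrite linearB fxy subrr.
Qed.

Lemma linear_lift_inj A B X (i : {linear A -> B}) (h : {linear X -> B}) :
  injective i -> (forall x, exists a, i a = h x) ->
  exists h' : {linear X -> A}, forall x, i (h' x) = h x.
Proof.
move=> i_inj /choice[h' h'P]; have h'_lin : linear h'.
  by move=> a x y; apply: i_inj; rewrite linearP !h'P linearP.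
by have [g gE] := linear_of h'_lin; exists g => x; rewrite gE.
Qed.

Lemma linear_factor_surj A B X (p : {linear X -> A}) (h : {linear X -> B}) :
  surj p -> (forall x, p x = 0 -> h x = 0) ->
  exists h' : {linear A -> B}, forall x, h' (p x) = h x.
Proof.
move=> /choice[s sK] ker_ph.
have hE x y : p x = p y -> h x = h y.
  move=> pxy; apply/eqP; rewrite -subr_eq0 -linearB; apply/eqP/ker_ph.
  by rewrite linearB pxy subrr.
have h'_lin : linear (h \o s).
  by move=> a x y /=; rewrite -linearP; apply: hE; rewrite linearP !sK.
by have [g gE] := linear_of h'_lin; exists g => x; rewrite gE; apply: hE.
Qed.

Section Kernel.
Variables (A B : lmodType R) (g : {linear A -> B}).
Definition kernel_pred : {pred A} := fun x => g x == 0.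
Fact kernel_closed : submod_closed kernel_pred.
Proof.
split=> [|a x y]; rewrite !unfold_in ?linear0 // linearP.
by move=> /eqP-> /eqP->; rewrite scaler0 addr0.
Qed.
HB.instance Definition _ := GRing.isSubmodClosed.Build R A kernel_pred kernel_closed.
Record kernel_type := Kernel {kernel_val : A; _ : kernel_val \in kernel_pred}.
HB.instance Definition _ := [isSub for kernel_val].
HB.instance Definition _ := [Choice of kernel_type by <:].
HB.instance Definition _ := [SubChoice_isSubLmodule of kernel_type by <:].
End Kernel.

Lemma kernel_exists A B (g : {linear A -> B}) :
  exists (K : lmodType R) (f : {linear K -> A}), injective f /\ exact_at f g.
Proof.
exists (kernel_type g), (val : {linear kernel_type g -> A}).
split; first exact: val_inj.
move=> y; split=> [/eqP gy|[x <-]]; first by exists (Kernel gy).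
by case: x => x /= /eqP.
Qed.

End LinearMaps.

Section ProjectiveDimension.
Local Open Scope ring_scope.
Variable R : nzRingType.
Implicit Types A B C M P K : lmodType R.

Definition short_exact A B C (i : {linear A -> B}) (p : {linear B -> C}) :=
  [/\ injective i, surj p & exact_at i p].

(** A recursive form of [pd_le], through syzygies: it suits inductions on d in
    which only one step of the resolution is built at a time. *)
Fixpoint pdim_le (d : nat) (M : lmodType R) : Prop :=
  if d is d'.+1 then
    exists (K P : lmodType R) (i : {linear K -> P}) (p : {linear P -> M}),
      [/\ projective P, short_exact i p & pdim_le d' K]
  else projective M.

Lemma projective_retract P B (s : {linear P -> B}) (p : {linear B -> P}) :
  (forall x, p (s x) = x) -> projective B -> projective P.
Proof.
move=> sK projB X Y g f g_surj.
have [h hP] := projB X Y g (f \o p : {linear _ -> _}) g_surj.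
by exists (h \o s : {linear _ -> _}) => x /=; rewrite hP /= sK.
Qed.

Lemma projective_prod A B : projective A -> projective B ->
  projective (A * B)%type.
Proof.
move=> projA projB X Y g f g_surj.
have inl_lin : linear (fun a : A => (a, 0 : B)).
  by move=> a x y; congr pair; rewrite /= scaler0 addr0.
have inr_lin : linear (fun b : B => (0 : A, b)).
  by move=> a x y; congr pair; rewrite /= scaler0 addr0.
have [u uE] := linear_of inl_lin; have [v vE] := linear_of inr_lin.
have [hA hAP] := projA X Y g (f \o u : {linear _ -> _}) g_surj.
have [hB hBP] := projB X Y g (f \o v : {linear _ -> _}) g_surj.
have h_lin : linear (fun ab : A * B => hA ab.1 + hB ab.2).
  by move=> a [x1 y1] [x2 y2] /=; rewrite !linearP scalerDr addrACA.
have [h hE] := linear_of h_lin; exists h => -[a b].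
rewrite hE linearD hAP hBP /= uE vE -linearD; congr (f _).
by congr pair; rewrite /= ?addr0 ?add0r.
Qed.

Lemma split_section B C (p : {linear B -> C}) :
  projective C -> surj p -> exists s : {linear C -> B}, forall x, p (s x) = x.
Proof. by move=> projC; apply: (projC _ _ p idfun). Qed.

Lemma projective_extension A B C (i : {linear A -> B}) (p : {linear B -> C}) :
  short_exact i p -> projective A -> projective C -> projective B.
Proof.
move=> [i_inj p_surj ip_ex] projA projC.
have [s sK] := split_section projC p_surj.
have e_lin : linear (fun ac : A * C => i ac.1 + s ac.2).
  by move=> a [x1 y1] [x2 y2] /=; rewrite !linearP scalerDr addrACA.
have [e eE] := linear_of e_lin.
have pi0 a : p (i a) = 0 by apply/ip_ex; exists a.
have d_lin : linear (fun b : B => b - s (p b)).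
  by move=> a x y /=; rewrite 2!linearP scalerBr opprD addrACA.
have [d dE] := linear_of d_lin.
have im_d b : exists a, i a = d b.
  by apply/ip_ex; rewrite dE linearB sK subrr.
have [r rE] := linear_lift_inj i_inj im_d.
have q_lin : linear (fun b : B => (r b, p b)).
  by move=> a x y; congr pair; rewrite /= linearP.
have [q qE] := linear_of q_lin.
apply: (@projective_retract _ _ q e) (projective_prod projA projC) => b.
by rewrite qE eE /= rE dE subrK.
Qed.

Lemma projective_zero P : (forall x : P, x = 0) -> projective P.
Proof.
move=> P0 X Y g f _; have z_lin : linear (fun _ : P => 0 : X).
  by move=> a x y; rewrite scaler0 addr0.
have [z zE] := linear_of z_lin.
by exists z => x; rewrite zE linear0 (P0 x) linear0.
Qed.

(** The identity of M with its zero kernel is the trivial first step of a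
    resolution of a projective module. *)
Lemma identity_short_exact M : exists (K : lmodType R) (i : {linear K -> M}),
  (forall x : K, x = 0) /\ short_exact i (idfun : {linear M -> M}).
Proof.
have [K [i [i_inj i_ex]]] := kernel_exists (idfun : {linear M -> M}).
exists K, i; split; last by split=> // y; exists y.
by move=> x; apply: i_inj; rewrite linear0; apply/i_ex; exists x.
Qed.

Lemma pdim_le_zero d M : (forall x : M, x = 0) -> pdim_le d M.
Proof.
elim: d M => [|d IHd] M M0; first exact: projective_zero.
have [K [i [K0 iP]]] := identity_short_exact M.
by exists K, M, i, idfun; split; [exact: projective_zero | | exact: IHd].
Qed.

Lemma pdim_leS d M : pdim_le d M -> pdim_le d.+1 M.
Proof.
elim: d M => [|d IHd] M.
  move=> projM; have [K [i [K0 iP]]] := identity_short_exact M.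
  by exists K, M, i, idfun; split=> //; apply: pdim_le_zero.
by case=> K [P [i [p [projP ipP /IHd pdK]]]]; exists K, P, i, p.
Qed.

Lemma pdim_leW d e M : (d <= e)%N -> pdim_le d M -> pdim_le e M.
Proof.
move=> /subnKC <- pdM; elim: (e - d)%N => [|m]; rewrite ?addn0 // addnS.
exact: pdim_leS.
Qed.

Lemma pdim_le_iso d A B (f : {linear A -> B}) :
  injective f -> surj f -> pdim_le d A -> pdim_le d B.
Proof.
move=> f_inj f_surj.
have [f' f'K] := linear_lift_inj (h := idfun) f_inj f_surj.
case: d => [|d]; first exact: (projective_retract f'K).
case=> K [P [i [p [projP [i_inj p_surj ip_ex] pdK]]]].
exists K, P, i, (f \o p : {linear _ -> _}); split=> //; split=> //.
  by move=> y; have [a <-] := f_surj y; have [x <-] := p_surj a; exists x.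
move=> y; rewrite -ip_ex /=; split=> [fpy|->]; last exact: linear0.
by apply: f_inj; rewrite fpy linear0.
Qed.

(** The sum of covers PA of A and PC of C covers B, by a lift of PC -> C through
    B; its kernel is an extension of the kernel over C by the kernel over A, so
    the induction applies to the kernels. *)
Lemma horseshoe d A B C (i : {linear A -> B}) (p : {linear B -> C}) :
  short_exact i p -> pdim_le d A -> pdim_le d C -> pdim_le d B.
Proof.
elim: d A B C i p => [|d IHd] A B C i p ip_ex; first exact: projective_extension ip_ex.
have [i_inj p_surj ip0] := ip_ex.
case=> KA [PA [iA [pA [projA [iA_inj pA_surj exA] pdA]]]].
case=> KC [PC [iC [pC [projC [iC_inj pC_surj exC] pdC]]]].
have [l lP] := projC _ _ p pC p_surj.
have g_lin : linear (fun ac : PA * PC => i (pA ac.1) + l ac.2).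
  by move=> a [x1 y1] [x2 y2] /=; rewrite !linearP scalerDr addrACA.
have [g gE] := linear_of g_lin.
have pi0 a : p (i a) = 0 by apply/ip0; exists a.
have [KB [iB [iB_inj exB]]] := kernel_exists g.
have g_surj : surj g.
  move=> b; have [c pc] := pC_surj (p b).
  have /ip0[a ia] : p (b - l c) = 0 by rewrite linearB lP pc subrr.
  by have [a' pa] := pA_surj a; exists (a', c); rewrite gE /= pa ia subrK.
exists KB, (PA * PC)%type, iB, g; split=> //; first exact: projective_prod.
have u_lin : linear (fun k : KA => (iA k, 0 : PC)).
  by move=> a x y; congr pair; rewrite /= ?linearP // scaler0 addr0.
have [u uE] := linear_of u_lin.
have [u' u'E] : exists u' : {linear KA -> KB}, forall x, iB (u' x) = u x.
  apply: linear_lift_inj => // x; apply/exB; rewrite gE uE /= linear0 addr0.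
  by have -> : pA (iA x) = 0 by [apply/exA; exists x]; rewrite linear0.
have v_lin : linear (fun k : KB => (iB k).2) by move=> a x y; rewrite linearP.
have [v vE] := linear_of v_lin.
have [v' v'E] : exists v' : {linear KB -> KC}, forall x, iC (v' x) = v x.
  apply: linear_lift_inj => // x; apply/exC; rewrite vE -lP.
  have : g (iB x) = 0 by apply/exB; exists x.
  by rewrite gE => /(congr1 p); rewrite linearD pi0 add0r linear0.
apply: (IHd _ _ _ u' v') => //; split.
- by move=> x y /(congr1 iB); rewrite !u'E !uE => -[/iA_inj].
- move=> c.
  have /ip0[a ia] : p (- l (iC c)) = 0.
    by rewrite linearN lP; apply/eqP; rewrite oppr_eq0; apply/eqP/exC; exists c.
  have [a' pa] := pA_surj a.
  have /exB[k kE] : g (a', iC c) = 0 by rewrite gE /= pa ia addNr.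
  by exists k; apply: iC_inj; rewrite v'E vE kE.
- move=> k; split.
    move=> /(congr1 iC); rewrite v'E vE linear0 => k2.
    have : g (iB k) = 0 by apply/exB; exists k.
    rewrite gE k2 linear0 addr0 -[RHS](linear0 i) => /i_inj/exA[a aE].
    by exists a; apply: iB_inj; rewrite u'E uE aE -k2; case: (iB k).
  case=> a <-; apply: iC_inj.
  by rewrite v'E vE u'E uE linear0.
Qed.

(** If P covers B with kernel K, then P also covers C, and the kernel L of
    P -> C is an extension of A by K.  Hence no chain map has to be lifted: the
    bound follows from [horseshoe] for L. *)
Lemma mapping_cone d A B C (i : {linear A -> B}) (p : {linear B -> C}) :
  short_exact i p -> pdim_le d A -> pdim_le d.+1 B -> pdim_le d.+1 C.
Proof.
move=> [i_inj p_surj ip_ex] pdA [K [P [iK [q [projP [iK_inj q_surj exK] pdK]]]]].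
have [L [iL [iL_inj exL]]] := kernel_exists (p \o q : {linear _ -> _}).
exists L, P, iL, (p \o q : {linear _ -> _}); split=> //.
  split=> // c; have [b <-] := p_surj c; have [x <-] := q_surj b.
  by exists x.
have [u uE] : exists u : {linear K -> L}, forall x, iL (u x) = iK x.
  apply: linear_lift_inj => // x; apply/exL => /=.
  by have -> : q (iK x) = 0 by [apply/exK; exists x]; rewrite linear0.
have [v vE] : exists v : {linear L -> A}, forall x, i (v x) = (q \o iL) x.
  by apply: (linear_lift_inj (h := q \o iL)) => // x; apply/ip_ex; apply/exL; exists x.
apply: (@horseshoe _ _ _ _ u v) => //; split.
- by move=> x y /(congr1 iL); rewrite !uE => /iK_inj.
- move=> a; have [x xE] := q_surj (i a).
  have /exL[y yE] : p (q x) = 0 by rewrite xE; apply/ip_ex; exists a.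
  by exists y; apply: i_inj; rewrite vE /= yE xE.
- move=> x; split=> [vx0|[y <-]].
    have /exK[y yE] : q (iL x) = 0 by rewrite -[LHS](vE x) vx0 linear0.
    by exists y; apply: iL_inj; rewrite uE.
  by apply: i_inj; rewrite vE /= uE linear0; apply/exK; exists y.
Qed.

(** Syzygies are spliced: the resolution of the kernel K is shifted by one and
    composed with K -> P. *)
Lemma pd_le_of_pdim_le d M : pdim_le d M -> pd_le M d.
Proof.
elim: d M => [|d IHd] M.
  move=> projM; have [Z [z [Z0 [z_inj _ z_ex]]]] := identity_short_exact M.
  (* The resolution of a projective M is M followed by zero modules. *)
  pose mods i : lmodType R := if i is 0 then M else Z.
  have projZ : projective Z by exact: projective_zero.
  unshelve eexists.
    apply: (@ProjResolution R M mods
      (fun i => if i is 0 then z else (idfun : {linear Z -> Z})) idfun).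
    - by case.
    - by move=> y; exists y.
    - exact: z_ex.
    - case=> [|i] y; split=> [_|[x _]]; rewrite ?[y]Z0 ?linear0 //.
        by exists 0; rewrite linear0.
      by exists 0.
  by case.
case=> K [P [i [p [projP [i_inj p_surj ip_ex] /IHd[Q Q_len]]]]].
unshelve eexists.
  apply: (@ProjResolution R M (fun i => if i is j.+1 then res_mod Q j else P)
    (fun j => if j is j'.+1 then res_diff Q j' else (i \o res_aug Q : {linear _ -> _})) p).
  - by case=> // j; apply: res_projective.
  - exact: p_surj.
  - move=> y; rewrite ip_ex /=; split=> -[x xE].
      by have [x' x'E] := @res_aug_surj _ _ Q x; exists x'; rewrite x'E.
    by exists (res_aug Q x).
  - case=> [|j] y; last exact: res_exactS.
    rewrite -(@res_exact0 _ _ Q) /=; split=> [iy|->]; last exact: linear0.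
    by apply: i_inj; rewrite iy linear0.
by case=> // j; apply: Q_len.
Qed.

Lemma pd_leW M d e : (d <= e)%N -> pd_le M d -> pd_le M e.
Proof. by move=> de [Q Q_len]; exists Q => i ei; apply: Q_len (leq_ltn_trans de ei). Qed.

End ProjectiveDimension.

(** * Koszul cochains and a lower bound for the projective dimension *)

Section Koszul.
Local Open Scope ring_scope.

Lemma subr_interchange (V : zmodType) :
  @interchange V (fun a b => a - b) (fun a b => a - b).
Proof. by move=> a b c d; rewrite !opprD !opprK addrACA. Qed.

Lemma morphB0 (U V : zmodType) (f : U -> V) : {morph f : a b / a - b} -> f 0 = 0.
Proof. by move=> fB; rewrite -[in LHS](subrr 0) fB subrr. Qed.

Variables (R : comNzRingType) (I : eqType) (x : I -> R).
Implicit Types (M N P : lmodType R) (r : seq I) (s : seq bool).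

(** The differential of the Koszul cochain complex of the elements [x i], for i
    in r.  Its basis vectors are the subsets of r, given as words of bits of
    length [size r]; the cohomological degree is the number of bits [true].  The
    recursion is the mapping cone of multiplication by the first element.
    Cochains are compared at words of length [size r]. *)
Fixpoint koszul M r (c : seq bool -> M) s : M :=
  match r, s with
  | i :: r', false :: s' => koszul r' (fun t => c (false :: t)) s'
  | i :: r', true :: s' => x i *: c (false :: s') - koszul r' (fun t => c (true :: t)) s'
  | _, _ => 0
  end.

(** Cochains are filtered rather than graded by degree: this is enough to
    recognise cocycles below the top degree, and degree 0 needs no convention. *)
Definition degree_lt M d (c : seq bool -> M) :=
  forall s, (d <= count id s)%N -> c s = 0.

(** Additive operators that divide by [x i] on the multiples of [x i] and
    commute with the other elements.  On polynomials they remove the monomials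
    not divisible by a variable and divide the others by it.  In their
    presence any uniq sequence of elements [x i] is regular on M. *)
Definition divisions M :=
  forall i, exists psi : M -> M, [/\ {morph psi : a b / a - b},
    forall a, psi (x i *: a) = a &
    forall j a, j != i -> psi (x j *: a) = x j *: psi a].

Lemma koszul_ext M r (c1 c2 : seq bool -> M) s :
  (forall t, size t = size r -> c1 t = c2 t) -> size s = size r ->
  koszul r c1 s = koszul r c2 s.
Proof.
elim: r s c1 c2 => [|i r IHr] [|b s] c1 c2 //= eq_c [s_r].
have eqk b' : koszul r (fun t => c1 (b' :: t)) s = koszul r (fun t => c2 (b' :: t)) s.
  by apply: IHr => // t t_r; apply: eq_c; rewrite /= t_r.
by case: b; rewrite !eqk // eq_c //= s_r.
Qed.

Lemma koszul_map M N r (f : M -> N) (c : seq bool -> M) s :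
  {morph f : a b / a - b} ->
  (forall i a, i \in r -> f (x i *: a) = x i *: f a) ->
  koszul r (fun t => f (c t)) s = f (koszul r c s).
Proof.
move=> fB; have f0 : f 0 = 0 by exact: morphB0.
elim: r s c => [|i r IHr] [|b s] c fZ //=.
have {}IHr b' :
    koszul r (fun t => f (c (b' :: t))) s = f (koszul r (fun t => c (b' :: t)) s).
  by apply: (IHr _ (fun t => c (b' :: t))) => j a jr; apply: fZ; rewrite inE jr orbT.
by case: b; rewrite IHr ?fB ?fZ // mem_head.
Qed.

Lemma koszulB M r (c1 c2 : seq bool -> M) s :
  koszul r (fun t => c1 t - c2 t) s = koszul r c1 s - koszul r c2 s.
Proof.
elim: r s c1 c2 => [|i r IHr] [|b s] c1 c2 /=; rewrite ?subrr //.
by case: b; rewrite IHr // scalerBr subr_interchange.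
Qed.

Lemma koszul0 M r s : koszul r (fun _ => 0 : M) s = 0.
Proof.
have := koszulB r (fun _ => 0 : M) (fun _ => 0) s.
by under eq_fun do rewrite subrr; rewrite subrr.
Qed.

Lemma koszul_sq M r (c : seq bool -> M) s : koszul r (koszul r c) s = 0.
Proof.
elim: r s c => [|i r IHr] [|b s] c //=; case: b => //=.
rewrite koszulB IHr subr0.
rewrite (koszul_map (f := fun a => x i *: a)) ?subrr //.
  by move=> a b; rewrite scalerBr.
by move=> j a _; rewrite !scalerA mulrC.
Qed.

Lemma koszul_degree M r (c : seq bool -> M) d :
  degree_lt d c -> degree_lt d.+1 (koszul r c).
Proof.
elim: r c d => [|i r IHr] c d c_d [|[] s] //= ds; last first.
  by apply: (IHr _ d) => // t dt; apply: c_d.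
rewrite c_d //= scaler0 sub0r; case: d c_d ds => [|d] c_d ds.
  rewrite (_ : (fun t => _) = fun _ => 0) ?koszul0 ?oppr0 //.
  by apply/funext => t; apply: c_d.
by rewrite (IHr _ d) ?oppr0 // => t dt; apply: c_d.
Qed.

(** Write a cocycle as the pair (c_f, c_t) of its restrictions to words starting
    with [false] and [true].  Then x c_f = D c_t, and so c_f = D (psi c_t).  The
    remainder phi c_t = c_t - x (psi c_t) is a cocycle for the remaining
    elements, of degree one less, hence a coboundary by induction. *)
Lemma koszul_exact M r (c : seq bool -> M) d :
  divisions M -> uniq r -> (d < size r)%N -> degree_lt d.+1 c ->
  (forall s, size s = size r -> koszul r c s = 0) ->
  exists2 b, degree_lt d b & forall s, size s = size r -> koszul r b s = c s.
Proof.
move=> divM; elim: r c d => [|i r IHr] c d //= /andP[i_r r_uniq] d_r c_d c_cycle.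
have [psi [psiB psiK psiC]] := divM i.
have psi0 : psi 0 = 0 by exact: morphB0.
have psi_koszul e s : koszul r (fun t => psi (e t)) s = psi (koszul r e s).
  by apply: koszul_map => // j a jr; apply: psiC; apply: contraNneq i_r => <-.
have eqD s : size s = size r ->
    koszul r (fun t => c (true :: t)) s = x i *: c (false :: s).
  move=> s_r; apply/esym/eqP; rewrite -subr_eq0; apply/eqP.
  by apply: (c_cycle (true :: s)); rewrite /= s_r.
pose phi := fun a => a - x i *: psi a.
have phi_koszul e s : koszul r (fun t => phi (e t)) s = phi (koszul r e s).
  apply: koszul_map => [a b|j a jr].
    by rewrite /phi psiB scalerBr subr_interchange.
  rewrite /phi psiC; last by apply: contraNneq i_r => <-.
  by rewrite scalerBr !scalerA mulrC.
have [b'' b''_d b''P] : exists2 b'', degree_lt d.-1 b'' &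
    forall s, size s = size r -> koszul r b'' s = phi (c (true :: s)).
  case: d d_r c_d => [|d] d_r c_d.
    exists (fun _ => 0) => // s _; rewrite koszul0 c_d // /phi psi0 scaler0.
    by rewrite subrr.
  apply: IHr => // [t dt|s s_r]; first by rewrite c_d // /phi psi0 scaler0 subrr.
  by rewrite phi_koszul eqD // /phi psiK subrr.
exists (fun s => match s with
  | false :: t => psi (c (true :: t)) | true :: t => - b'' t | [::] => 0 end).
  case=> [|[] t] //= dt; first by rewrite b''_d ?oppr0 //; case: d {d_r c_d b''_d} dt.
  by rewrite c_d.
case=> [|[] s] //= [s_r].
  rewrite (koszul_map (f := -%R)); first by rewrite opprK b''P // addrC subrK.
    by move=> a b; rewrite opprD.
  by move=> j a _; rewrite scalerN.
by rewrite psi_koszul eqD.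
Qed.

(** A chase in the double complex of Koszul cochains with values in a resolution
    Q.  The rows are exact by definition, and the columns below the top degree
    by [koszul_exact].  The hypothesis on p and p' says that p gives a Koszul
    cocycle modulo the image of [res_diff Q j]; the conclusion says that it is
    a coboundary modulo that image.  The descending induction on j starts beyond
    the length of Q. *)
Lemma resolution_chase M r (Q : proj_resolution M) d j
    (p : seq bool -> res_mod Q j) (p' : seq bool -> res_mod Q j.+1) :
  (forall i, divisions (res_mod Q i)) -> uniq r -> length_le Q d -> (d < size r)%N ->
  degree_lt j.+1 p -> degree_lt j.+2 p' ->
  (forall s, size s = size r -> koszul r p s = res_diff Q j (p' s)) ->
  exists2 t : seq bool -> res_mod Q j.+1, degree_lt j.+1 t &
  exists2 q, degree_lt j q &
  forall s, size s = size r -> p s = res_diff Q j (t s) + koszul r q s.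
Proof.
move=> divQ r_uniq Q_len d_r.
have [e le_e] := ubnP (d.+1 - j); elim: e j p p' le_e => // e IHe j p p' le_e p_j p'_j eqp.
have [dj|jd] := ltnP d j.
  exists (fun _ => 0) => //; exists (fun _ => 0) => // s _.
  by rewrite linear0 koszul0 addr0; apply: Q_len.
have diff_koszul (f : seq bool -> res_mod Q j.+1) s :
    koszul r (fun t => res_diff Q j (f t)) s = res_diff Q j (koszul r f s).
  apply: koszul_map => [a b|i a _]; [exact: linearB|exact: linearZ].
(* D p' lies in the kernel of the differential of Q, because D D p = 0. *)
have lift s : exists y, size s = size r -> koszul r p' s = res_diff Q j.+1 y.
  case: (eqVneq (size s) (size r)) => [s_r|/eqP s_r]; last by exists 0.
  have /(@res_exactS _ _ Q)[y yE] : res_diff Q j (koszul r p' s) = 0.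
    rewrite -diff_koszul -(koszul_sq r p s); apply: koszul_ext => // t t_r.
    by rewrite eqp.
  by exists y.
have [p0 p0P] := choice lift.
(* Above degree j + 2 the cochain D p' vanishes, and 0 is a preimage there. *)
pose p'' s := if (j.+3 <= count id s)%N then 0 else p0 s.
have p''_j : degree_lt j.+3 p'' by rewrite /p'' => s ->.
have [||t' t'_j [q' q'_j eqp']] := IHe j.+1 p' p'' _ p'_j p''_j.
- by rewrite subnS; move: le_e; rewrite ltnS subSn // => /ltnW; case: (d - j)%N.
- move=> s s_r; rewrite /p''; case: ifP => [js|_]; last exact: p0P.
  by rewrite linear0; apply: koszul_degree js.
have [||q q_j qP] := koszul_exact (c := fun s => p s - res_diff Q j (q' s)) (divQ j) r_uniq
  (leq_ltn_trans jd d_r).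
- by move=> s js; rewrite p_j // q'_j // linear0 subrr.
- move=> s s_r; have dd : res_diff Q j (res_diff Q j.+1 (t' s)) = 0.
    by apply/(@res_exactS _ _ Q); exists (t' s).
  by rewrite koszulB diff_koszul eqp // eqp' // linearD dd add0r subrr.
exists q' => //; exists q => // s s_r.
by rewrite qP // addrC subrK.
Qed.

(** A preimage a' of a in degree 0 of a resolution is a Koszul cocycle modulo the
    first syzygies.  If the resolution were shorter than r, the chase would
    exhibit a' as an element of these syzygies, as there are no coboundaries in
    degree 0; so a would vanish. *)
Lemma annihilated_pd_ge M r (a : M) d :
  (forall P, projective P -> divisions P) -> uniq r ->
  a != 0 -> (forall i, i \in r -> x i *: a = 0) -> pd_le M d -> (size r <= d)%N.
Proof.
move=> divP r_uniq a_n0 xa0 [Q Q_len]; rewrite leqNgt; apply/negP => d_r.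
have divQ i : divisions (res_mod Q i) by apply: divP; apply: res_projective.
have [a' a'P] := @res_aug_surj _ _ Q a.
pose p s : res_mod Q 0%N := if s == nseq (size r) false then a' else 0.
have p_0 : degree_lt 1 p.
  by rewrite /p => s; case: eqP => // ->; rewrite count_nseq.
have aug_koszul s : res_aug Q (koszul r p s) = 0.
  rewrite -koszul_map; [|exact: linearB|by move=> i b _; exact: linearZ].
  rewrite /p; under eq_fun do rewrite fun_if a'P linear0.
  move: {a' a'P p p_0 d_r divQ r_uniq} xa0; elim: r s => [|i r IHr] [|[] s] xa0 //=.
    rewrite [koszul _ _ _](koszul0 _ r s) subr0; case: ifP => _; last by rewrite scaler0.
    by rewrite xa0 ?mem_head.
  by apply: IHr => j jr; rewrite xa0 // inE jr orbT.
have /choice[p1 p1P] s : exists y, res_diff Q 0 y = koszul r p s.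
  by apply/(@res_exact0 _ _ Q).
pose p' s := if (2 <= count id s)%N then 0 else p1 s.
have p'_1 : degree_lt 2 p' by rewrite /p' => s ->.
have [|t _ [q q_0 pE]] := @resolution_chase M r Q d 0 p p' divQ r_uniq Q_len d_r p_0 p'_1.
  move=> s s_r; rewrite /p'; case: ifP => [js|_]; last by rewrite p1P.
  by rewrite linear0; apply: koszul_degree js.
move/eqP: a_n0; apply; have := pE (nseq (size r) false); rewrite size_nseq => /(_ erefl).
rewrite /p eqxx (_ : koszul _ _ _ = 0) ?addr0; last first.
  by rewrite (_ : q = fun _ => 0) ?koszul0 //; apply/funext => s; apply: q_0.
by rewrite -a'P => ->; apply/(@res_exact0 _ _ Q); exists (t (nseq (size r) false)).
Qed.

End Koszul.

(** * Divisions on projective modules *)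

Section FreeModule.
Local Open Scope ring_scope.
Variable R : comNzRingType.

Lemma free_cover (M : lmodType R) (K : choiceType) (h : K -> M) :
  exists f : {linear {malg R[K]} -> M}, forall k a, f (mkmalgU k a) = a *: h k.
Proof.
pose f (g : {malg R[K]}) := \sum_(k <- monalg.msupp g) monalg.mcoeff k g *: h k.
have fE (d : {fset K}) g : fsubset (monalg.msupp g) d ->
    f g = \sum_(k <- d) monalg.mcoeff k g *: h k.
  move=> gd; rewrite /f (big_fset_incl _ gd) // => k _ /monalg.mcoeff_outdom->.
  by rewrite scale0r.
have f_lin : linear f.
  move=> a g1 g2; pose d := fsetU (monalg.msupp g1)
    (fsetU (monalg.msupp g2) (monalg.msupp (a *: g1 + g2))).
  rewrite !(fE d) ?scaler_sumr -?big_split /=.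
  - by apply: eq_bigr => k _; rewrite monalg.mcoeffD monalg.mcoeffZ scalerDl scalerA.
  - by rewrite /d fsetUCA fsubsetUl.
  - exact: fsubsetUl.
  - by rewrite /d fsetUA fsubsetUr.
have [F FE] := linear_of f_lin; exists F => k a.
by rewrite FE (fE (fset1 k)) ?msuppU_le // big_seq_fset1 mcoeffUU.
Qed.

Variables (I : eqType) (x : I -> R).

(** On a free module the divisions act on coordinates. *)
Lemma divisions_free (K : choiceType) : divisions x R^o -> divisions x ({malg R[K]}).
Proof.
move=> divR i; have [psi [psiB psiK psiC]] := divR i.
have psi0 := morphB0 psiB.
pose Psi (g : {malg R[K]}) : {malg R[K]} :=
  [malg k in monalg.msupp g => psi (monalg.mcoeff k g)].
have PsiE g k : monalg.mcoeff k (Psi g) = psi (monalg.mcoeff k g).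
  by rewrite mcoeffE; case: monalg.msuppP.
exists Psi; split=> [a b|a|j a ji]; apply/malgP => k.
- by rewrite !(PsiE, monalg.mcoeffB) psiB.
- by rewrite PsiE monalg.mcoeffZ psiK.
- by rewrite PsiE !monalg.mcoeffZ psiC // PsiE.
Qed.

(** A projective module P is a retract of the free module on its elements, and
    divisions are transported along retracts because the embedding and the
    retraction are linear. *)
Lemma divisions_projective (P : lmodType R) :
  divisions x R^o -> projective P -> divisions x P.
Proof.
move=> divR projP i.
have [f fE] := free_cover (id : P -> P).
have f_surj : surj f by move=> y; exists (mkmalgU y 1); rewrite fE scale1r.
have [s sK] := split_section projP f_surj.
have [psi [psiB psiK psiC]] := divisions_free P divR i.
exists (f \o psi \o s); split=> [a b|a|j a ji] /=.
- by rewrite !linearB psiB linearB.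
- by rewrite linearZ psiK sK.
- by rewrite linearZ psiC // linearZ.
Qed.

End FreeModule.

(** * Monomial ideals and their colon ideals *)

Section Quotients.
Local Open Scope ring_scope.

(** Up to isomorphism M is V / J, with projection p.  Quotients are handled
    through p alone, independently of how they are constructed. *)
Definition presents (R : nzRingType) (V M : lmodType R) (J : V -> Prop)
    (p : {linear V -> M}) :=
  surj p /\ forall v, p v = 0 <-> J v.

Lemma quot_mod_presents (R : nzRingType) (V : lmodType R) (J : {pred V})
    (J_closed : submod_closed J) :
  exists p : {linear V -> quot_mod J_closed}, presents (fun v => v \in J) p.
Proof.
pose q (v : V) : quot_mod J_closed := (\pi_(Quotient.quot (submod_pred J_closed)) v)%qT.
have q_lin : linear q.
  by move=> a u v; rewrite /q Quotient.pi_add -quot_scale_pi.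
have [p pE] := linear_of q_lin; exists p; split.
  by move=> y; exists (repr y)%qT; rewrite pE /q reprK.
move=> v; rewrite -[0](linear0 p) !pE /q; split=> [|Jv].
  by move=> /eqP; rewrite -Quotient.idealrBE subr0.
by apply/eqP; rewrite -Quotient.idealrBE subr0.
Qed.

Variable R : comNzRingType.
Implicit Types (A B C : lmodType R).

(** The sequence 0 -> R / (J : f) -> R / J -> R / (J + (f)) -> 0, whose first map
    is multiplication by f. *)
Lemma colon_sequence A B C (JA J JC : R^o -> Prop) (f : R)
    (a : {linear R^o -> A}) (b : {linear R^o -> B}) (c : {linear R^o -> C}) :
  presents JA a -> presents J b -> presents JC c ->
  (forall p, JA p <-> J (p * f)) ->
  (forall p, JC p <-> exists q, J (p - q * f)) ->
  exists (i : {linear A -> B}) (p : {linear B -> C}), short_exact i p.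
Proof.
move=> [a_surj aP] [b_surj bP] [c_surj cP] JAE JCE.
have h_lin : linear (fun p : R^o => b (p * f)).
  by move=> r p q; rewrite mulrDl -scalerAl linearP.
have [h hE] := linear_of h_lin.
have [|i iE] := linear_factor_surj (h := h) a_surj.
  by move=> p /aP/JAE/bP; rewrite hE.
have [|g gE] := linear_factor_surj (h := c) b_surj.
  by move=> p /bP Jp; apply/cP/JCE; exists 0; rewrite mul0r subr0.
exists i, g; split.
- apply: linear_inj0 => y; have [p <-] := a_surj y.
  by rewrite iE hE => /bP/JAE/aP.
- by move=> y; have [p <-] := c_surj y; exists (b p); rewrite gE.
- move=> y; split.
    have [p <-] := b_surj y; rewrite gE => /cP/JCE[q /bP].
    rewrite linearB => /eqP; rewrite subr_eq0 => /eqP->.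
    by exists (a q); rewrite iE hE.
  case=> z <-; have [p <-] := a_surj z; rewrite iE hE gE.
  by apply/cP/JCE; exists p; apply/bP; rewrite subrr linear0.
Qed.

Lemma projective_regular : projective (R^o : lmodType R).
Proof.
move=> A B g f g_surj; have [y yE] := g_surj (f 1).
have h_lin : linear (fun p : R^o => p *: y).
  by move=> r p q; rewrite scalerDl scalerA.
have [h hE] := linear_of h_lin; exists h => p.
by rewrite hE linearZ yE -linearZ; congr (f _); apply: mulr1.
Qed.

End Quotients.

Section MonomialIdeals.
Local Open Scope ring_scope.
Variables (n : nat) (k : fieldType).
Local Notation S := {mpoly k[n]}.
Implicit Types (p q : S) (m : 'X_{1..n}) (i j : 'I_n) (U : 'X_{1..n} -> Prop).

Lemma mnm1_le i m : (0 < m i)%N -> (U_(i) <= m)%MM.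
Proof. by move=> mi; apply/mnm_lepP => j; rewrite mnm1E; case: eqP => // <-. Qed.

(** The quotient of p by 'X_i, monomials without 'X_i being dropped. *)
Definition mdivX i p : S :=
  \sum_(m <- msupp p | (0 < m i)%N) p@_m *: 'X_[m - U_(i)].

Lemma mcoeff_mdivX i p m : (mdivX i p)@_m = p@_(m + U_(i)).
Proof.
rewrite raddf_sum /=.
have mK m' : (0 < m' i)%N -> (m' - U_(i) == m)%MM = (m' == m + U_(i))%MM.
  move=> m'i; apply/eqP/eqP=> [<-|->]; last by rewrite addmK.
  by rewrite submK ?mnm1_le.
under eq_bigr => m' m'i do rewrite mcoeffZ mcoeffX mK // mulr_natr mulrb.
rewrite -big_mkcondr /=.
have [m_p|m_p] := boolP ((m + U_(i))%MM \in msupp p); last first.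
  rewrite big_seq_cond big1 ?(memN_msupp_eq0 m_p) //.
  by move=> m' /and3P[m'p _ /eqP m'E]; rewrite m'E (negPf m_p) in m'p.
rewrite -big_filter (_ : [seq _ <- _ | _] = [:: (m + U_(i))%MM]) ?big_seq1 //.
rewrite (eq_filter (a2 := pred1 (m + U_(i))%MM)) => [|m' /=].
  by rewrite filter_pred1_uniq.
by case: eqP => [->|_]; rewrite ?andbF // mnmDE mnm1E eqxx addn1.
Qed.

Lemma mcoeff_mulXi i p m :
  ('X_i * p)@_m = if (0 < m i)%N then p@_(m - U_(i)) else 0.
Proof.
rewrite mulrC; case: ifP => mi.
  by rewrite -{1}(submK (mnm1_le mi)) addmC mcoeffMX.
apply: memN_msupp_eq0; rewrite (perm_mem (msuppMX _ _)); apply/mapP => -[m' _ mE].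
by move: mi; rewrite mE mnmDE mnm1E eqxx.
Qed.

Lemma divisions_mpolyX : divisions (fun i => 'X_i : S) (S^o : lmodType S).
Proof.
move=> i; exists (mdivX i); split=> [p q|p|j p ji]; apply/mpolyP => m;
  rewrite !(mcoeffB, mcoeff_mdivX, mcoeff_mulXi) //.
  by rewrite mnmDE mnm1E eqxx addn1 /= addmK.
rewrite mnmDE mnm1E eq_sym (negPf ji) addn0; case: ifP => // mj.
congr (_@__); apply/mnmP => l; rewrite !(mnmDE, mnmBE, mnm1E).
by case: eqVneq => [<-|]; rewrite ?(negPf ji) ?addn0 ?subn0.
Qed.

Definition up_closed U := forall m m', U m -> U (m' + m)%MM.

(** A monomial ideal is given by the set U of its monomials.  Colons and sums with
    a variable then become operations on predicates: U (m + U_(i)) and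
    U m \/ 0 < m i. *)
Definition mono_ideal U : {pred S^o} := fun p => `[< forall m, p@_m != 0 -> U m >].

Lemma mono_idealP U p : reflect (forall m, p@_m != 0 -> U m) (p \in mono_ideal U).
Proof. exact: asboolP. Qed.

Lemma mono_ideal_closed U : up_closed U -> submod_closed (mono_ideal U).
Proof.
move=> U_up; split=> [|a p q /mono_idealP Up /mono_idealP Uq]; apply/mono_idealP => m.
  by rewrite mcoeff0 eqxx.
have [qm|qm _] := eqVneq q@_m 0; last exact: Uq.
rewrite mcoeffD qm addr0 -mcoeff_msupp => /msuppM_le/allpairsP[[m1 m2] [_ /= m2p ->]].
by apply/U_up/Up; rewrite -mcoeff_msupp.
Qed.

Lemma mono_idealX U m : 'X_[m] \in mono_ideal U <-> U m.
Proof.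
split=> [/mono_idealP|Um]; first by apply; rewrite mcoeffX eqxx oner_eq0.
by apply/mono_idealP => m'; rewrite mcoeffX; case: (m =P m') => [<- //|_]; rewrite eqxx.
Qed.

(** Any presentation of the quotient may serve as a witness; the one imposed by
    [edge_quotient] is reached at the end, by [mono_pd_transfer]. *)
Definition mono_pd_le U d := exists (M : lmodType S) (p : {linear S^o -> M}),
  presents (fun v => v \in mono_ideal U) p /\ pdim_le d M.

Lemma mono_presented U : up_closed U -> exists (M : lmodType S)
  (p : {linear S^o -> M}), presents (fun v => v \in mono_ideal U) p.
Proof.
move=> U_up; have [p pP] := quot_mod_presents (mono_ideal_closed U_up).
by exists (quot_mod (mono_ideal_closed U_up)), p.
Qed.

Lemma mono_colon U i p :
  p \in mono_ideal (fun m => U (m + U_(i))%MM) <-> p * 'X_i \in mono_ideal U.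
Proof.
split=> /mono_idealP Up; apply/mono_idealP => m.
  rewrite mulrC mcoeff_mulXi; case: ifP => [mi /Up|]; last by rewrite eqxx.
  by rewrite submK ?mnm1_le.
by move=> pm; apply: Up; rewrite addmC mcoeffMX.
Qed.

Lemma mono_sum U i p :
  p \in mono_ideal (fun m => U m \/ (0 < m i)%N) <->
  exists q, p - q * 'X_i \in mono_ideal U.
Proof.
split=> [/mono_idealP Up|[q /mono_idealP Uq]].
  exists (mdivX i p); apply/mono_idealP => m; rewrite mcoeffB mulrC mcoeff_mulXi.
  case: ifP => mi; last by rewrite subr0 => /Up[]//; rewrite mi.
  by rewrite mcoeff_mdivX submK ?mnm1_le // subrr eqxx.
apply/mono_idealP => m pm; case: (boolP (0 < m i)%N) => mi; [by right|left].
by apply: Uq; rewrite mcoeffB mulrC mcoeff_mulXi (negPf mi) subr0.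
Qed.

Lemma mono_pd_ext U V d : (forall m, U m <-> V m) -> mono_pd_le U d -> mono_pd_le V d.
Proof. by move=> UV; rewrite (_ : U = V) //; apply/funext => m; apply/propext. Qed.

Lemma mono_pd_leW U d e : (d <= e)%N -> mono_pd_le U d -> mono_pd_le U e.
Proof. by move=> de [M [p [pP Md]]]; exists M, p; split=> //; apply: pdim_leW Md. Qed.

Lemma mono_pd_empty : mono_pd_le (fun _ => False) 0.
Proof.
exists S^o, idfun; split; last exact: projective_regular.
split=> [y|p]; first by exists y.
split=> /= [->|/mono_idealP p0]; first by apply/mono_idealP => m; rewrite mcoeff0 eqxx.
by apply/mpolyP => m; rewrite mcoeff0; apply/eqP/negPn/negP => /p0.
Qed.

Lemma up_closed_sum U i : up_closed U -> up_closed (fun m => U m \/ (0 < m i)%N).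
Proof.
move=> U_up m m' [/U_up|mi]; first by left.
by right; rewrite mnmDE addn_gt0 mi orbT.
Qed.

(** This is [horseshoe] for the colon sequence at 'X_i. *)
Lemma mono_pd_colon U i d : up_closed U ->
  mono_pd_le (fun m => U (m + U_(i))%MM) d ->
  mono_pd_le (fun m => U m \/ (0 < m i)%N) d ->
  mono_pd_le U d.
Proof.
move=> U_up [A [a [aP Ad]]] [C [c [cP Cd]]].
have [B [b bP]] := mono_presented U_up; exists B, b; split=> //.
have [f [g fg]] := colon_sequence aP bP cP (mono_colon U i) (mono_sum U i).
exact: horseshoe fg Ad Cd.
Qed.

(** When U does not depend on 'X_i, this variable is regular modulo the ideal, so
    the colon sequence has S / U as its first two terms. *)
Lemma mono_pd_add_var U i d : up_closed U ->
  (forall m, U (m + U_(i))%MM -> U m) ->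
  mono_pd_le U d -> mono_pd_le (fun m => U m \/ (0 < m i)%N) d.+1.
Proof.
move=> U_up Ui [A [a [aP Ad]]].
have [C [c cP]] := mono_presented (up_closed_sum (i := i) U_up); exists C, c; split=> //.
have colonE p : p \in mono_ideal U <-> p * 'X_i \in mono_ideal U.
  rewrite -mono_colon; split=> /mono_idealP Up; apply/mono_idealP => m /Up; last exact: Ui.
  by move=> Um; rewrite addmC; apply: U_up.
have [f [g fg]] := colon_sequence aP aP cP colonE (mono_sum U i).
exact: mapping_cone fg Ad (pdim_leS Ad).
Qed.

Lemma mono_pd_transfer U d (M : lmodType S) (p : {linear S^o -> M}) :
  presents (fun v => v \in mono_ideal U) p -> mono_pd_le U d -> pdim_le d M.
Proof.
move=> [p_surj pP] [A [a [[a_surj aP] Ad]]].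
have [|f fE] := linear_factor_surj (h := p) a_surj; first by move=> v /aP/pP.
apply: pdim_le_iso Ad; last by move=> y; have [v <-] := p_surj y; exists (a v).
by apply: linear_inj0 => y; have [v <-] := a_surj y; rewrite fE => /pP/aP.
Qed.

End MonomialIdeals.

(** * Edge ideals: deleting vertices and covering vertices *)

Section EdgeIdealDepth.
Local Open Scope ring_scope.
Variables (k : fieldType) (T : finType) (e : rel T).
Hypotheses (e_sym : ssrbool.symmetric e) (e_irr : irreflexive e).
Local Notation n := #|T|.
Implicit Types (m : 'X_{1..n}) (A : {set T}) (v : T) (r : seq T).

(** The monomials divisible by an edge of the subgraph induced on A. *)
Definition edge_mono A m := exists u w, [/\ u \in A, w \in A, e u w,
  (0 < m (enum_rank u))%N & (0 < m (enum_rank w))%N].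

Lemma edge_mono_up A : up_closed (edge_mono A).
Proof.
move=> m m' [u [w [uA wA uw mu mw]]]; exists u, w.
by split; rewrite // mnmDE addn_gt0 ?mu ?mw orbT.
Qed.

Lemma mnm_addU v u m :
  (0 < (m + U_(enum_rank v))%MM (enum_rank u))%N = (0 < m (enum_rank u))%N || (u == v).
Proof.
rewrite mnmDE mnm1E addn_gt0 eq_sym (inj_eq enum_rank_inj) lt0b.
by rewrite eq_sym.
Qed.

Lemma mono_pd_add_vars A r d : uniq r -> {in r, forall v, v \notin A} ->
  mono_pd_le k (edge_mono A) d ->
  mono_pd_le k (fun m => edge_mono A m \/ exists2 v, v \in r & (0 < m (enum_rank v))%N)
    (d + size r).
Proof.
elim: r => [|v r IHr] /=.
  by rewrite addn0 => _ _; apply: mono_pd_ext => m; split=> [|[]//]; [left | case].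
move=> /andP[v_r r_uniq] rA pdA; rewrite addnS.
have {}IHr := IHr r_uniq (fun u ur => rA u (mem_behead (s := v :: r) ur)) pdA.
have vA : v \notin A by apply: rA; rewrite mem_head.
apply: mono_pd_ext; last first.
  apply: (mono_pd_add_var (i := enum_rank v)) IHr => [m m' [/edge_mono_up|[u ur mu]]|m].
  - by left.
  - by right; exists u => //; rewrite mnmDE addn_gt0 mu orbT.
  - case=> [[u [w [uA wA uw]]]|[u ur]]; rewrite !mnm_addU.
      have /negPf-> : u != v by apply: contraNneq vA => <-.
      have /negPf-> : w != v by apply: contraNneq vA => <-.
      by rewrite !orbF => mu mw; left; exists u, w.
    have /negPf-> : u != v by apply: contraNneq v_r => <-.
    by rewrite orbF; right; exists u.
move=> m; split=> [[[|[u ur mu]]|mv]|[|[u]]]; try by left.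
- by right; exists u; rewrite // inE ur orbT.
- by right; exists v; rewrite // mem_head.
- by left; left.
- by rewrite inE => /predU1P[->|ur] mu; [right | left; right; exists u].
Qed.

(** The colon by v of the edge ideal of A is the edge ideal of A without the closed
    neighbourhood of v, together with the neighbours of v in A as variables; each
    of these variables costs one. *)
Lemma mono_pd_vertex A v d d' : v \in A ->
  mono_pd_le k (edge_mono (A :\ v)) d ->
  mono_pd_le k (edge_mono [set w in A :\ v | ~~ e v w]) d' ->
  (d' + #|[set w in A | e v w]| <= d.+1)%N ->
  mono_pd_le k (edge_mono A) d.+1.
Proof.
move=> vA pd_del pd_link le_d.
apply: (mono_pd_colon (i := enum_rank v)); first exact: edge_mono_up.
  apply: mono_pd_leW le_d _; rewrite [#|[set w in A | e v w]|]cardE.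
  apply: mono_pd_ext; last first.
    apply: mono_pd_add_vars pd_link; first exact: enum_uniq.
    by move=> w; rewrite mem_enum !inE => /andP[_ ->]; rewrite andbF.
  move=> m; split.
    case=> [[u [w [uA wA uw mu mw]]]|[w]].
      exists u, w; rewrite !mnm_addU mu mw; move: uA wA; rewrite !inE.
      by case/andP=> /andP[_ ->] _ /andP[/andP[_ ->] _].
    rewrite mem_enum inE => /andP[wA vw] mw; exists v, w.
    by rewrite !mnm_addU eqxx orbT mw.
  case=> u [w [uA wA uw]]; rewrite !mnm_addU.
  have [uv|uv] := eqVneq u v.
    have [wv|wv] := eqVneq w v; first by rewrite uv wv e_irr in uw.
    rewrite orbF => _ mw; right; exists w => //.
    by rewrite mem_enum inE wA -uv.
  have [wv|wv] := eqVneq w v; rewrite !orbF => mu mw.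
    by right; exists u => //; rewrite mem_enum inE uA -wv e_sym.
  have [vu|vu] := boolP (e v u).
    by right; exists u => //; rewrite mem_enum inE uA.
  have [vw|vw] := boolP (e v w).
    by right; exists w => //; rewrite mem_enum inE wA.
  by left; exists u, w; rewrite !inE uv wv uA wA vu vw.
apply: mono_pd_ext; last first.
  apply: (mono_pd_add_var (i := enum_rank v)) pd_del; first exact: edge_mono_up.
  move=> m [u [w []]]; rewrite !inE !mnm_addU.
  move=> /andP[/negPf uv uA] /andP[/negPf wv wA] uw; rewrite uv wv !orbF => mu mw.
  by exists u, w; rewrite !inE uv wv.
move=> m; split=> -[|]; try by right.
  by case=> u [w []]; rewrite !inE => /andP[_ ?] /andP[_ ?] *; left; exists u, w.
case=> u [w [uA wA uw mu mw]].
have [<-|uv] := eqVneq u v; first by right.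
have [<-|wv] := eqVneq w v; first by right.
by left; exists u, w; rewrite !inE uv wv.
Qed.

(** By the Auslander-Buchsbaum formula this says that the quotient of k[A] by the
    edge ideal of the subgraph induced on A has depth at least delta.  Counting
    depth instead of projective dimension makes the recursion below independent
    of degrees. *)
Definition depth_ge A delta := exists d,
  mono_pd_le k (edge_mono A) d /\ (d + delta <= #|A|)%N.

Lemma depth_ge_edgeless A delta : {in A &, forall u w, ~~ e u w} ->
  (delta <= #|A|)%N -> depth_ge A delta.
Proof.
move=> Ae leA; exists 0%N; split=> //; apply: mono_pd_ext (mono_pd_empty _ k).
by move=> m; split=> // -[u [w [uA wA uw _ _]]]; have := Ae _ _ uA wA; rewrite uw.
Qed.

(** The #|N(v)| variables added in the colon ideal are compensated by the same
    number of vertices missing from the link, and v itself leaves one unit of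
    depth to spare. *)
Lemma depth_ge_vertex A v delta : v \in A ->
  depth_ge (A :\ v) delta -> depth_ge [set w in A :\ v | ~~ e v w] delta.-1 ->
  depth_ge A delta.
Proof.
move=> vA [d [pd_del le_d]] [d' [pd_link le_d']].
pose D := [set w in A | e v w].
have cardA : #|A| = (#|A :\ v|).+1 by rewrite (cardsD1 v) vA.
have cardL : #|A :\ v| = (#|[set w in A :\ v | ~~ e v w]| + #|D|)%N.
  rewrite -(cardsID [set w | ~~ e v w] (A :\ v)); congr (_ + _)%N; apply: eq_card => w.
    by rewrite !inE.
  by rewrite !inE negbK; case: eqVneq => [->|_]; rewrite ?e_irr ?andbF //= andbC.
exists (maxn d (d' + #|D|).-1).+1; split.
  apply: (mono_pd_vertex vA) pd_link _.
    by apply: mono_pd_leW pd_del; apply: leq_maxl.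
  by rewrite -/D; lia.
rewrite cardA cardL; move: le_d le_d'; rewrite cardL; lia.
Qed.

(** The generators are monomials, and conversely a monomial divisible by an edge
    is a multiple of a generator. *)
Lemma edge_ideal_mono p :
  p \in edge_ideal (k := k) e <-> p \in mono_ideal (edge_mono setT).
Proof.
split=> [/asboolP[c ->]|/mono_idealP Up].
  have [J0 JD] := mono_ideal_closed k (@edge_mono_up setT).
  apply: (big_ind (fun p => p \in mono_ideal (edge_mono setT))) => //.
    by move=> p1 p2 p1J; have := JD 1 p1 p2 p1J; rewrite scale1r.
  move=> [u w] /= uw.
  suff /(JD (c (u, w)) _ 0)/(_ J0) : vertex_var k u * vertex_var k w \in
      mono_ideal (edge_mono setT) by rewrite addr0.
  rewrite /vertex_var -mpolyXD; apply/mono_idealX; exists u, w.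
  by rewrite !inE !mnmDE !mnm1E !eqxx addn1.
have [J0 JD] := edge_ideal_submod_closed k e.
rewrite (mpolyE p) big_seq.
apply: (big_ind (fun p => p \in edge_ideal (k := k) e)) => //.
  by move=> p1 p2 p1J; have := JD 1 p1 p2 p1J; rewrite scale1r.
move=> m; rewrite mcoeff_msupp => /Up[u [w [_ _ uw mu mw]]].
apply/asboolP; exists (fun ab => if ab == (u, w) then
  p@_m *: 'X_[m - U_(enum_rank u) - U_(enum_rank w)] else 0).
rewrite (bigD1 (u, w)) //= eqxx big1 ?addr0; last first.
  by move=> ab /andP[_ /negPf->]; rewrite mul0r.
rewrite -scalerAl /vertex_var -!mpolyXD; congr (_ *: 'X_[_]).
have uw' : enum_rank u != enum_rank w.
  by rewrite (inj_eq enum_rank_inj); apply: contraTneq uw => ->; rewrite e_irr.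
rewrite [(U_(enum_rank u) + _)%MM]addmC addmA submK ?submK ?mnm1_le //.
by rewrite mnmBE mnm1E (negPf uw') subn0.
Qed.

Lemma edge_quotient_presents :
  exists p : {linear (vertex_ring k T)^o -> edge_quotient k e},
  presents (fun q => q \in mono_ideal (edge_mono setT)) p.
Proof.
have [p [p_surj pP]] := quot_mod_presents (edge_ideal_submod_closed k e).
by exists p; split=> // v; rewrite pP; apply: edge_ideal_mono.
Qed.

Lemma graph_pd_le_depth delta : depth_ge setT delta -> exists2 d,
  graph_pd_le k e d & (d + delta <= #|T|)%N.
Proof.
move=> [d [pdH le_d]]; exists d; last by rewrite -cardsT.
have [p pP] := edge_quotient_presents.
exact: pd_le_of_pdim_le (mono_pd_transfer pP pdH).
Qed.

(** The projective dimension is at least the size of every minimal vertex cover.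
    The complement A of such a cover is a maximal independent set; the product of
    the variables in A is not in the edge ideal, but multiplying it by any other
    variable produces an edge. *)
Lemma graph_pd_ge_cover A d : {in A &, forall u w, ~~ e u w} ->
  (forall v, v \notin A -> exists2 u, u \in A & e v u) ->
  graph_pd_le k e d -> (#|T| - #|A| <= d)%N.
Proof.
move=> A_indep A_max pdH; have [p [p_surj pP]] := edge_quotient_presents.
have divS (P : lmodType (vertex_ring k T)) :
    projective P -> divisions (fun i => 'X_i : vertex_ring k T) P.
  exact/divisions_projective/divisions_mpolyX.
pose m0 : 'X_{1..n} := [multinom (enum_val i \in A : nat) | i < n].
have m0E v : m0 (enum_rank v) = (v \in A) by rewrite mnmE enum_rankK.
have -> : (#|T| - #|A| = size (map enum_rank (enum (~: A))))%N.
  by rewrite size_map -cardE -(cardsC A) addKn.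
apply: (annihilated_pd_ge (a := p 'X_[m0]) divS) => //.
- by rewrite map_inj_uniq ?enum_uniq //; apply: enum_rank_inj.
- apply/eqP => /pP/mono_idealX[u [w [_ _ uw]]]; rewrite !m0E !lt0b => uA wA.
  by rewrite (negPf (A_indep _ _ uA wA)) in uw.
- move=> i /mapP[v]; rewrite mem_enum inE => vA ->.
  have [u uA vu] := A_max v vA.
  rewrite -linearZ; apply/pP; rewrite [_ *: _](_ : _ = 'X_[U_(enum_rank v) + m0]).
    apply/mono_idealX; exists v, u; rewrite !inE !mnmDE mnm1E eqxx !m0E uA.
    by rewrite addn1.
  by rewrite mpolyXD.
Qed.

End EdgeIdealDepth.

(** * Upper neighbourhoods in connected closed graphs *)

Section Intervals.
Variable N : nat.

Lemma sum_itv a b : \sum_(i < N) ((a <= i < b) : nat) = minn b N - a.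
Proof.
elim: N => [|M IHM]; first by rewrite big_ord0; lia.
by rewrite big_ord_recr /= IHM; lia.
Qed.

Lemma card_pred_sum (P : pred 'I_N) : #|P| = \sum_(i < N) (P i : nat).
Proof. by rewrite -sum1_card big_mkcond. Qed.

Lemma card_ge_itv2 (P : pred 'I_N) a1 b1 a2 b2 : b1 <= a2 -> b2 <= N -> b1 <= N ->
  (forall i : 'I_N, (a1 <= i < b1) || (a2 <= i < b2) -> P i) ->
  (b1 - a1) + (b2 - a2) <= #|P|.
Proof.
move=> b1a2 b2N b1N itvP; rewrite card_pred_sum.
have := sum_itv a1 b1; have := sum_itv a2 b2.
rewrite (minn_idPl b1N) (minn_idPl b2N) => <- <-; rewrite -big_split /=.
by apply: leq_sum => i _; have := itvP i; case: (P i); lia.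
Qed.

(** A set of ordinals that is closed downwards above a lower bound a is an
    interval, and its length is its cardinality. *)
Lemma initial_segment (P : pred 'I_N) a :
  (forall j, P j -> a <= j) ->
  (forall j k : 'I_N, P j -> a <= k <= j -> P k) ->
  forall j, P j = (a <= j < a + #|P|).
Proof.
move=> aP downP j; apply/idP/idP => [Pj|/andP[aj jP]].
  rewrite aP //=; have jN := ltn_ord j.
  have := aP j Pj; suff : (j.+1 - a) + (j.+1 - j.+1) <= #|P| by lia.
  by apply: card_ge_itv2 => // i iaj; apply: (downP j) => //; lia.
apply/negPn/negP => nPj.
have : #|P| <= minn j N - a.
  rewrite -sum_itv card_pred_sum; apply: leq_sum => i _; case: (boolP (P i)) => // Pi.
  rewrite aP //= lt0b ltnNge; apply: contra nPj => ji.
  by apply: (downP i) => //; rewrite aj.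
have := ltn_ord j; lia.
Qed.

End Intervals.

Section ClosedGraphs.
Variables (n : nat) (G : rel 'I_n).
Hypotheses (G_sym : ssrbool.symmetric G) (G_irr : irreflexive G).
Hypotheses (G_conn : connected_graph G) (G_closed : closed_graph G).

Let up : rel 'I_n := fun a b => (a < b) && G a b.

Lemma connect_first (T : finType) (e : rel T) x z :
  connect e x z -> x = z \/ exists2 u, e x u & connect e u z.
Proof.
move=> /connectP[[|u p] /= ep ->]; first by left.
by case/andP: ep => xu ep; right; exists u => //; apply/connectP; exists p.
Qed.

Lemma connect_last (T : finType) (e : rel T) x z :
  connect e x z -> x = z \/ exists2 u, connect e x u & e u z.
Proof.
move=> /connectP[p]; case/lastP: p => [_ ->|p w]; first by left.
rewrite rcons_path last_rcons => /andP[ep epw] ->; right; exists (last x p) => //.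
by apply/connectP; exists p.
Qed.

(** An increasing path from x to z followed by a descending edge z w can be
    straightened: closedness joins w to the vertex u that precedes z on the path,
    and the path to u is shorter. *)
Lemma up_step_from x z w : connect up x z -> G z w -> connect up x w || connect up w x.
Proof.
have [d] := ubnP (z : nat); elim: d z w => // d IHd z w zd xz zw.
case: (ltngtP z w) => [lt_zw|lt_wz|/val_inj eq_zw].
- by rewrite (connect_trans xz) //; apply: connect1; rewrite /up lt_zw.
- have [->|[u xu /andP[lt_uz uz]]] := connect_last xz.
    by rewrite orbC connect1 //= /up lt_wz G_sym.
  have [<-|u_w] := eqVneq u w; first by rewrite xu.
  apply: IHd (xu) _; first exact: leq_trans lt_uz _.
  by apply: (G_closed (i := z)); rewrite // 1?G_sym // lt_uz lt_wz orbT.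
- by rewrite eq_zw G_irr in zw.
Qed.

(** The mirror image of [up_step_from]. *)
Lemma up_step_to x z w : connect up z x -> G z w -> connect up x w || connect up w x.
Proof.
have [d] := ubnP (n - z); elim: d z w => // d IHd z w zd zx zw.
case: (ltngtP z w) => [lt_zw|lt_wz|/val_inj eq_zw].
- have [<-|[u /andP[lt_zu zu] ux]] := connect_first zx.
    by rewrite connect1 //= /up lt_zw.
  have [<-|u_w] := eqVneq u w; first by rewrite ux orbT.
  apply: IHd (ux) _; first by have := ltn_ord u; lia.
  by apply: (G_closed (i := z)); rewrite // lt_zu lt_zw.
- rewrite orbC (connect_trans _ zx) //.
  by apply: connect1; rewrite /up lt_wz G_sym.
- by rewrite eq_zw G_irr in zw.
Qed.

(** A path is straightened one edge at a time. *)
Lemma connect_up_total x y : connect up x y || connect up y x.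
Proof.
have /connectP[p xp ->] := G_conn x y.
suff H z : connect up x z || connect up z x -> path G z p ->
    connect up x (last z p) || connect up (last z p) x.
  by apply: H; rewrite ?connect0.
elim: p z {xp} => //= w p IHp z xz /andP[zw]; apply: IHp.
by case/orP: xz => [/up_step_from|/up_step_to]; apply.
Qed.

Lemma connect_up_leq x y : connect up x y -> x <= y.
Proof.
move=> /connectP[p]; elim: p x => [|z p IHp] x /=; first by move=> _ ->.
by move=> /andP[/andP[/ltnW xz _] zp] /(IHp _ zp); apply: leq_trans.
Qed.

(** An increasing path between consecutive labels has a single edge. *)
Lemma closed_succ (i j : 'I_n) : i.+1 = j :> nat -> G i j.
Proof.
move=> ij; case/orP: (connect_up_total i j) => [c_ij|/connect_up_leq]; last by lia.
have [eq_ij|[u /andP[iu Giu] /connect_up_leq uj]] := connect_first c_ij.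
  by move: ij; rewrite eq_ij; lia.
by have -> : j = u by apply/val_inj => /=; lia.
Qed.

(** Walking from i to k along consecutive labels, closedness keeps every vertex
    adjacent to j; then i and k are both smaller neighbours of j. *)
Lemma closed_up_nbhd (i j k : 'I_n) : i < k <= j -> G i j -> G i k.
Proof.
move=> /andP[ik kj] ij; have [->//|k_j] := eqVneq k j.
have {kj} lt_kj : k < j by rewrite ltn_neqAle k_j.
have kGj : G k j.
  have [d] := ubnP (k : nat); elim: d k ik {k_j} lt_kj => // d IHd k ik lt_kj kd.
  have pk : k.-1 < n by have := ltn_ord k; lia.
  pose k' := Ordinal pk; have k'E : k'.+1 = k by rewrite /=; lia.
  have k'j : G k' j.
    case: (ltngtP i k') => [lt_ik'|lt_k'i|/val_inj<-//]; last by lia.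
    by apply: IHd => //; lia.
  have k_j : k != j by rewrite neq_ltn lt_kj.
  apply: (G_closed (i := k')) => //; first exact: closed_succ.
  by apply/orP; left; apply/andP; split; lia.
have i_k : i != k by rewrite neq_ltn ik.
apply: (G_closed (i := j)); rewrite // 1?G_sym //.
by apply/orP; right; apply/andP; split; lia.
Qed.

End ClosedGraphs.

(** The columns adjacent to x_i form an interval starting at i, of length the
    degree of x_i; so it ends where mu_i says. *)
Lemma initial_closed_edges n (H : rel ('I_n.-1 + 'I_n.-1)) :
  initial_closed H ->
  [/\ ssrbool.symmetric H, irreflexive H,
      forall i j, H (inl i) (inl j) = false, forall i j, H (inr i) (inr j) = false &
      forall i j : 'I_n.-1, H (inl i) (inr j) = (i <= j < n.-1 - nth 0 (mu H) i)].
Proof.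
move=> [n_gt1 [G [[G_sym G_irr] G_conn G_closed _ HE]]]; split.
- by move=> [i|i] [j|j]; rewrite !HE.
- by move=> [i|i]; rewrite HE.
- by move=> i j; rewrite HE.
- by move=> i j; rewrite HE.
move=> i j; pose P (j : 'I_n.-1) := H (inl i) (inr j).
have PE j' : P j' = (i <= j') && G (ord_keep i) (ord_succ j').
  by rewrite /P HE /= ltnS.
have degP : degree H (inl i) = #|P|.
  rewrite /degree -!sum1_card big_sumType /= big1 ?add0n; first exact: eq_bigl.
  by move=> j'; rewrite inE HE.
have seg := @initial_segment _ P i.
have {seg}-> : H (inl i) (inr j) = (i <= j < i + #|P|).
  apply: seg => [j'|j' k]; first by rewrite PE => /andP[].
  rewrite !PE => /andP[ij' Gij'] /andP[ik kj']; rewrite ik /=.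
  by apply: closed_up_nbhd Gij' => //=; lia.
have -> : nth 0 (mu H) i = n - i.+1 - degree H (inl i) by rewrite -tnth_nth tnth_mktuple.
rewrite degP; congr (_ && (_ < _)).
have : #|P| <= minn n.-1 n.-1 - i.
  rewrite -(sum_itv n.-1 i n.-1) card_pred_sum; apply: leq_sum => j' _.
  by case: (boolP (P j')) => //; rewrite PE => /andP[-> _]; rewrite ltn_ord.
have := ltn_ord i; lia.
Qed.

(** * Staircase bipartite graphs and the theorem *)

Section Staircase.
Variables (k : fieldType) (N : nat) (H : rel ('I_N + 'I_N)) (lam : nat -> nat).
Hypotheses (H_sym : ssrbool.symmetric H) (H_irr : irreflexive H).
Hypotheses (H_ll : forall i j, H (inl i) (inl j) = false).
Hypotheses (H_rr : forall i j, H (inr i) (inr j) = false).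
Hypotheses (H_lr : forall i j : 'I_N, H (inl i) (inr j) = (i <= j < lam i)).
Hypothesis lam_mono : {homo lam : i j / i <= j}.
Implicit Types (p q : pred nat) (v : 'I_N + 'I_N).

Lemma H_rl (i j : 'I_N) : H (inr j) (inl i) = (i <= j < lam i).
Proof. by rewrite H_sym H_lr. Qed.

Definition rows_cols p q : {set 'I_N + 'I_N} :=
  [set v : 'I_N + 'I_N | match v with inl i => p i | inr j => q j end].

Lemma card_rows_cols p q :
  #|rows_cols p q| = #|[pred i : 'I_N | p i]| + #|[pred j : 'I_N | q j]|.
Proof.
rewrite -!sum1_card big_sumType /=; congr (_ + _); apply: eq_bigl => i;
  by rewrite !inE.
Qed.

Definition block_depth p q d := depth_ge k H (rows_cols p q) d.

Lemma block_depth_eq p1 q1 p2 q2 d :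
  (forall i, i < N -> p1 i = p2 i) -> (forall j, j < N -> q1 j = q2 j) ->
  block_depth p1 q1 d -> block_depth p2 q2 d.
Proof.
move=> pE qE; rewrite /block_depth (_ : rows_cols p1 q1 = rows_cols p2 q2) //.
by apply/setP => -[i|j]; rewrite !inE ?pE ?qE.
Qed.

Lemma block_depth_edgeless p q d :
  (forall i j, i < N -> j < N -> p i -> q j -> ~~ (i <= j < lam i)) ->
  d <= #|[pred i : 'I_N | p i]| + #|[pred j : 'I_N | q j]| -> block_depth p q d.
Proof.
rewrite -card_rows_cols => pq; apply: depth_ge_edgeless => -[i|i] [j|j];
  rewrite !inE ?H_ll ?H_rr //.
  by rewrite H_lr => pi qj; apply: pq.
by rewrite H_rl => qi pj; apply: pq.
Qed.

Lemma block_depth_row p q p' q' (a : nat) d : a < N -> p a ->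
  (forall i, i < N -> p' i = p i && (i != a)) ->
  (forall j, j < N -> q' j = q j && ~~ (a <= j < lam a)) ->
  block_depth p' q d -> block_depth p' q' d.-1 -> block_depth p q d.
Proof.
move=> aN pa p'E q'E del link; pose v : 'I_N + 'I_N := inl (Ordinal aN).
apply: (@depth_ge_vertex _ _ _ H_sym H_irr _ v); rewrite ?inE //.
  rewrite (_ : _ :\ v = rows_cols p' q) //.
  by apply/setP => -[i|j]; rewrite !inE ?p'E // andbC.
rewrite (_ : [set _ in _ | _] = rows_cols p' q') //.
apply/setP => -[i|j]; rewrite !inE ?p'E ?q'E // ?H_ll ?H_lr //=.
by rewrite andbT andbC.
Qed.

Lemma block_depth_col p q p' q' (c : nat) d : c < N -> q c ->
  (forall i, i < N -> p' i = p i && ~~ (i <= c < lam i)) ->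
  (forall j, j < N -> q' j = q j && (j != c)) ->
  block_depth p q' d -> block_depth p' q' d.-1 -> block_depth p q d.
Proof.
move=> cN qc p'E q'E del link; pose v : 'I_N + 'I_N := inr (Ordinal cN).
apply: (@depth_ge_vertex _ _ _ H_sym H_irr _ v); rewrite ?inE //.
  rewrite (_ : _ :\ v = rows_cols p q') //.
  by apply/setP => -[i|j]; rewrite !inE ?q'E // andbC.
rewrite (_ : [set _ in _ | _] = rows_cols p' q') //.
apply/setP => -[i|j]; rewrite !inE ?p'E ?q'E // ?H_rr ?H_rl //=.
by rewrite andbT andbC.
Qed.

Variables (s delta : nat).
Hypotheses (s_le : s < N) (s_lam : forall i, s <= lam i).
Hypothesis lam_full : forall i, s <= i -> N <= lam i.
(* As lam j = N - mu_j, this bounds delta by mu_j + (j + 1): the row of index j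
   is x_(j+1). *)
Hypothesis delta_le : forall j, j < s -> delta + lam j <= N + j.+1.
Hypothesis delta_N : delta <= N.

(** The rows between a and t, whose column intervals are nested above [lam a], form
    a Ferrers graph; the rows beyond c and the columns before a are isolated.
    Removing the last row, which has the longest interval, leaves a smaller
    Ferrers graph; its link is edgeless. *)
Lemma ferrers_depth a c t : a < t -> t <= s -> lam a <= c -> c < N ->
  block_depth [pred i | (a < i < t) && (lam i <= c) || (c < i)]
              [pred j | (j < a) || (lam a <= j < c)] delta.-2.
Proof.
move=> at_ ts lam_a cN; have sa := s_lam a.
elim: t at_ ts => // t IHt; rewrite ltnS leq_eqVlt => /predU1P[<-|a_t] ts.
  apply: block_depth_edgeless => [i j iN jN|] /=; first by lia.
  have delta_a := delta_le ts.
  by apply: leq_trans (leq_add (@card_ge_itv2 _ _ c.+1 N N N _ _ _ _)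
    (@card_ge_itv2 _ _ 0 a (lam a) c _ _ _ _)); rewrite /=; lia.
have {}IHt := IHt a_t (ltnW ts).
have lam_at := lam_mono (ltnW a_t); have lam_t i := @lam_mono i t.
have [t_c|c_t] := leqP (lam t) c; last first.
  apply: block_depth_eq IHt => //= i iN; rewrite !ltnS [i <= t]leq_eqVlt.
  by case: (eqVneq i t) => [->|_]; [lia|].
apply: (block_depth_row (a := t)
  (p' := [pred i | (a < i < t) && (lam i <= c) || (c < i)])
  (q' := [pred j | (j < a) || (lam t <= j < c)])) => //=; try lia.
apply: block_depth_edgeless => [i j iN jN|] /=; first by have := lam_t i; lia.
have delta_t := delta_le ts.
apply: leq_trans (leq_add (@card_ge_itv2 _ _ a.+1 t c.+1 N _ _ _ _)
  (@card_ge_itv2 _ _ 0 a (lam t) c _ _ _ _)); rewrite /=; try lia.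
by move=> i; have := lam_t i; lia.
Qed.

(** The case a = 0 is the link of column c in the first c + 1 columns.  The link
    of the first remaining row is a Ferrers graph, because a < s <= lam a. *)
Lemma trapezoid_depth a c : a <= s -> c < N ->
  block_depth [pred i | (a <= i) && (lam i <= c) || (c < i)] [pred j | j < c] delta.-1.
Proof.
move=> le_as cN; have [d] := ubnP (s - a); elim: d a le_as => // d IHd a.
rewrite leq_eqVlt => /predU1P[->|lt_as] le_d.
  apply: block_depth_edgeless => [i j iN jN|] /=.
    by have := @lam_full i; lia.
  apply: leq_trans (leq_add (@card_ge_itv2 _ _ c.+1 N N N _ _ _ _)
    (@card_ge_itv2 _ _ 0 c c c _ _ _ _)); rewrite /= ?leqnn //; try lia.
have {}IHd :
    block_depth [pred i | (a < i) && (lam i <= c) || (c < i)] [pred j | j < c] delta.-1.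
  by apply: IHd; lia.
have [a_c|c_a] := leqP (lam a) c; last first.
  apply: block_depth_eq IHd => //= i iN; rewrite [a <= i]leq_eqVlt.
  by case: (eqVneq a i) => [<-|_]; [lia|].
have sa := s_lam a.
apply: (block_depth_row (a := a)
  (p' := [pred i | (a < i) && (lam i <= c) || (c < i)])
  (q' := [pred j | (j < a) || (lam a <= j < c)])) => //=; try lia.
apply: block_depth_eq (ferrers_depth lt_as (leqnn s) a_c cN) => //= i iN.
by have := @lam_full i; lia.
Qed.

(** Columns are removed from the right; with none left there are N isolated
    rows. *)
Lemma truncated_depth c : c <= N -> block_depth predT [pred j | j < c] delta.
Proof.
elim: c => [|c IHc] cN.
  apply: block_depth_edgeless => //=.
  apply: leq_trans (leq_addr _ _); apply: leq_trans (@card_ge_itv2 _ _ 0 N N N _ _ _ _);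
    rewrite //=; lia.
apply: (block_depth_col (c := c) (p' := [pred i | (lam i <= c) || (c < i)])
  (q' := [pred j | j < c])) => //=; try lia.
- exact: IHc (ltnW cN).
- exact: (@trapezoid_depth 0).
Qed.

(** For delta = min (mu_j + j) this is the announced bound on the depth. *)
Lemma staircase_depth : depth_ge k H setT delta.
Proof.
have := truncated_depth (leqnn N); rewrite /block_depth (_ : rows_cols _ _ = setT) //.
by apply/setP => -[i|j]; rewrite !inE /= ?ltn_ord.
Qed.

End Staircase.

Theorem theorem2p11 (k : fieldType) (n s : nat)
  (H : rel ('I_n.-1 + 'I_n.-1)) (m : s.-tuple nat)
  (H_initial_closed : initial_closed H)
  (s_range : (1 <= s <= n - 3)%N)
  (muH : mu H = m ++ nseq (n.-1 - s) 0%N :> seq nat)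
  (m_pos : (0 < last 0%N m)%N) (m_noninc : sorted geq m)
  (mu1_lt : (head 0%N m < n - s)%N) :
  graph_pd_le k H (\max_(j < s) (2 * n.-1 - (tnth m j + j.+1)))%N /\
  (sorted gtn m -> graph_pd_eq k H (2 * n.-1 - (last 0%N m + s))%N).
Proof.
have [H_sym H_irr H_ll H_rr H_lr] := initial_closed_edges H_initial_closed.
set N := n.-1 in H H_initial_closed muH H_sym H_irr H_ll H_rr H_lr *.
have sN : s < N by rewrite /N; lia.
pose mu' := nth 0 m; pose lam i := N - mu' i.
have geq_trans : transitive geq by move=> a b c ab bc; apply: leq_trans bc ab.
have mu'0 i : s <= i -> mu' i = 0 by move=> si; rewrite /mu' nth_default ?size_tuple.
have mu'_mono i j : i <= j -> mu' j <= mu' i.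
  move=> ij; have [sj|js] := leqP s j; first by rewrite mu'0.
  by apply: (sorted_leq_nth geq_trans (fun x => leqnn x)) => //;
    rewrite inE size_tuple // (leq_ltn_trans ij).
have mu'_lt i : mu' i <= N - s.
  by apply: leq_trans (mu'_mono 0 i isT) _; rewrite /mu' nth0 /N; lia.
have last_mu : last 0 m = mu' s.-1 by rewrite /mu' -nth_last size_tuple.
have lamE (i : 'I_N) : N - nth 0 (mu H) i = lam i.
  rewrite muH nth_cat size_tuple nth_nseq if_same /lam; case: ltnP => // si.
  by rewrite mu'0.
have {}H_lr i j : H (inl i) (inr j) = (i <= j < lam i) by rewrite H_lr lamE.
have lam_mono : {homo lam : i j / i <= j}.
  by move=> i j ij; rewrite /lam leq_sub2l ?mu'_mono.
have s_lam i : s <= lam i by rewrite /lam; have := mu'_lt i; lia.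
have lam_full i : s <= i -> N <= lam i by move=> si; rewrite /lam mu'0 ?subn0.
set D := \max_(j < s) _.
have D_ge j : j < s -> 2 * N - (mu' j + j.+1) <= D.
  move=> js; rewrite /D; apply: (@bigmax_sup _ (Ordinal js)) => //=.
  by rewrite (tnth_nth 0).
have D_le : D <= 2 * N by apply/bigmax_leqP => j _; apply: leq_subr.
have card_V : #|{: 'I_N + 'I_N}| = 2 * N by rewrite card_sum card_ord mul2n addnn.
have upper : graph_pd_le k H D.
  have [||d pdH dD] := graph_pd_le_depth H_irr
    (@staircase_depth k N H lam H_sym H_irr H_ll H_rr H_lr lam_mono s (2 * N - D) sN
      s_lam lam_full _ _).
  - by move=> j js; have := D_ge j js; have := mu'_lt j; rewrite /lam; lia.
  - by have := D_ge 0 (ltac:(lia)); have := mu'_lt 0; lia.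
  - by apply: pd_leW pdH; rewrite card_V in dD; lia.
split=> // m_decr.
have mu'_S j : j.+1 < s -> mu' j.+1 < mu' j.
  move=> js; have gtn_trans : transitive gtn by move=> a b c ab bc; apply: ltn_trans bc ab.
  by apply: (sorted_ltn_nth gtn_trans 0 m_decr); rewrite ?inE ?size_tuple // ltnW.
(* Strict decrease of mu makes j + mu_j nonincreasing. *)
have mu'_decr j : j < s -> mu' s.-1 + s <= mu' j + j.+1.
  move=> js; have [d] := ubnP (s - j); elim: d j js => // d IHd j js jd.
  have [js'|js'] := ltnP j.+1 s; last by have -> : s = j.+1 by lia.
  by have := IHd j.+1 js'; have := mu'_S j js'; lia.
have D_eq : 2 * N - (mu' s.-1 + s) = D.
  apply/eqP; rewrite eqn_leq; apply/andP; split.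
    have := D_ge s.-1 (ltac:(lia)); lia.
  apply/bigmax_leqP => j _; rewrite (tnth_nth 0); have := mu'_decr j (ltn_ord j).
  by rewrite -/(mu' j); lia.
rewrite last_mu D_eq; split=> // e pde; rewrite -D_eq.
(* A maximal independent set: the first s rows and the last mu_s columns. *)
pose A := rows_cols N [pred i | i < s] [pred j | lam s.-1 <= j].
have cardA : #|A| = s + mu' s.-1.
  rewrite card_rows_cols !card_pred_sum; congr (_ + _).
    by rewrite (eq_bigr (fun i : 'I_N => (0 <= i < s) : nat)) // sum_itv; lia.
  rewrite (eq_bigr (fun j : 'I_N => (lam s.-1 <= j < N) : nat)) => [|j _].
    by rewrite sum_itv /lam; have := mu'_lt s.-1; lia.
  by rewrite /= ltn_ord andbT.
have A_indep : {in A &, forall u w, ~~ H u w}.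
  move=> [i|i] [j|j]; rewrite !inE /= ?H_ll ?H_rr //.
    by move=> si js; rewrite H_lr; have := @lam_mono i s.-1; lia.
  by move=> js si; rewrite H_sym H_lr; have := @lam_mono j s.-1; lia.
have A_max v : v \notin A -> exists2 u, u \in A & H v u.
  case: v => [i|j]; rewrite !inE /= -?leqNgt -?ltnNge => v_out.
    have lt_N : N.-1 < N by lia.
    exists (inr (Ordinal lt_N)); rewrite ?inE ?H_lr /=.
      have := m_pos; rewrite last_mu /lam; lia.
    by have := lam_full i v_out; have := ltn_ord i; lia.
  have [js|sj] := ltnP j s.
    exists (inl j); rewrite ?inE // H_sym H_lr leqnn; exact: leq_trans js (s_lam j).
  have lt_N : s.-1 < N by lia.
  exists (inl (Ordinal lt_N)); first by rewrite inE /=; lia.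
  by rewrite H_sym H_lr /= v_out andbT; lia.
by have := graph_pd_ge_cover H_irr A_indep A_max pde; rewrite cardA card_V [s + _]addnC.
Qed.
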